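(* Let $H$ be a separable infinite-dimensional complex Hilbert space, let $I$ be the identity operator on $H$, and let $K$ be a non-negative (self-adjoint) compact operator on $H$ of infinite rank. Then $I+K$ is not a real linear combination of three orthoprojections, i.e. there do not exist real numbers $\beta_1,\beta_2,\beta_3$ and orthoprojections $Q_1,Q_2,Q_3$ on $H$ with $I+K=\beta_1Q_1+\beta_2Q_2+\beta_3Q_3$.
   Context: An orthoprojection on $H$ is a bounded operator $P$ on $H$ with $P=P^*=P^2$. Non-negative means $(Kx,x)\ge 0$ for all $x\in H$. *)

(* Defs.v *)
From HB Require Import structures.
From mathcomp Require Import all_boot all_order all_algebra.
From mathcomp Require Import sesquilinear complex.
From mathcomp Require Import all_classical all_reals all_analysis.

Set Implicit Arguments.
Unset Strict Implicit.
Unset Printing Implicit Defensive.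

Import Order.TTheory GRing.Theory Num.Theory.
Import numFieldNormedType.Exports.

Local Open Scope classical_set_scope.
Local Open Scope ring_scope.
Local Open Scope complex_scope.

Definition separable (T : topologicalType) : Prop :=
  exists D : set T, countable D /\ dense D.

Definition finite_dimensional (F : nzRingType) (V : lmodType F) (A : set V) : Prop :=
  exists (n : nat) (e : 'I_n -> V),
    forall x, A x -> exists c : 'I_n -> F, x = \sum_(i < n) c i *: e i.

Definition infinite_rank (F : nzRingType) (V : lmodType F) (T : V -> V) : Prop :=
  ~ finite_dimensional (range T).

Section Operators.
Variables (R : realType) (H : normedModType R[i]).

Definition bounded_operator (T : H -> H) : Prop :=
  exists M : R, forall x, `|T x| <= M%:C * `|x|.

Definition compact_operator (T : H -> H) : Prop :=
  precompact (T @` [set x | `|x| <= 1]).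

(* A form in {dot H for Num.conj} is linear in its first argument and
   conjugate-linear in its second. *)
Variable dot : {dot H for Num.conj}.

Definition adjoint (T S : H -> H) : Prop :=
  forall x y, dot (T x) y = dot x (S y).

Definition self_adjoint (T : H -> H) : Prop := adjoint T T.

(* In the order of R[i], 0 <= z means that z is real and non-negative. *)
Definition nonneg_operator (T : H -> H) : Prop := forall x, 0 <= dot (T x) x.

Definition orthoprojection (P : {linear H -> H}) : Prop :=
  [/\ bounded_operator P, self_adjoint P & forall x, P (P x) = P x].

End Operators.

(* Main.v *)
Require Import Defs.
From HB Require Import structures.
From mathcomp Require Import all_boot all_order all_algebra.
From mathcomp Require Import sesquilinear complex.
From mathcomp Require Import all_classical all_reals all_analysis.
From mathcomp Require Import ring lra.

Set Implicit Arguments.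
Unset Strict Implicit.
Unset Printing Implicit Defensive.

Import Order.TTheory GRing.Theory Num.Theory.
Import numFieldNormedType.Exports.

Local Open Scope classical_set_scope.
Local Open Scope ring_scope.
Local Open Scope complex_scope.


(** Only the real part of the inner product is used: H is regarded as a real
    Hilbert space V, and a property is said to hold on a subspace of finite
    codimension when it holds on the orthogonal complement of some finite list
    of vectors (the filter [cofinite]).  The conclusion that contradicts the
    infinite rank of K is that K vanishes on such a subspace.

    Suppose that I + K = b1 Q1 + b2 Q2 + b3 Q3, and put
    D = b1 Q1 + b2 Q2 - (b1 + b2)/2 and W = Q1 Q2 - Q2 Q1.  Two projections
    always satisfy D W = - W D, and W^2 is, up to the factor (b1 b2)^2, a
    quartic polynomial in D with real roots ([centred_sum_anticomm],
    [centred_sum_quartic]).  So, apart from the at most four eigenvalues that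
    D has on the kernel of W, the spectrum of D is symmetric about 0.  On the
    other hand D = c Q3 + a (I - Q3) + K with a = 1 - (b1 + b2)/2 and
    c = a - b3.  As K is compact and non-negative, the spectrum of D can
    accumulate only at a and at c, and only from above.  A symmetric set
    which accumulates at a point from above also accumulates at the opposite
    point from below; hence the spectrum of D is finite, (D - a)(D - c) has
    finite rank, and because K is non-negative it has finite rank too.

    This is carried out without spectral resolutions.  An odd polynomial g
    of degree at most 3, which depends on the signs of a and c, is chosen so
    that g(D) >= 0 on a subspace of finite codimension ([odd_cubic_exists], [odd_cubic_nonneg]).  The
    operator E = (D^2 - a^2)(D^2 - c^2) is compact and commutes with W, so
    that S = E g(D) E is compact, anticommutes with W and is non-negative on a
    subspace of finite codimension.  Now W maps eigenvectors of S with
    positive eigenvalue to eigenvectors with negative eigenvalue, of which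
    only finitely many are independent; therefore S W = 0 on a subspace of
    finite codimension ([anticommuting_nonneg_small]).  Composing once more
    with W, a non-zero polynomial in D with real roots vanishes on such a
    subspace.  Since (D - a)(D - c) is compact, it then has finite rank
    ([finite_rank_of_factors]), and because K >= 0 this forces K to have
    finite rank ([finite_rank_K]). *)

(** * Real Hilbert spaces and operators on them *)

(** Completeness is stated with sequences and squared norms, so that no topology
    has to be put on the carrier. *)
Record realHilbert (R : realType) := RealHilbert {
  hilbert_sort :> lmodType R;
  hdot : hilbert_sort -> hilbert_sort -> R;
  hdotC : forall x y, hdot x y = hdot y x;
  hdotDl : forall x y z, hdot (x + y) z = hdot x z + hdot y z;
  hdotZl : forall a x y, hdot (a *: x) y = a * hdot x y;
  hdot_gt0 : forall x, x != 0 -> 0 < hdot x x;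
  hcomplete : forall u : nat -> hilbert_sort,
    (forall e, 0 < e -> exists N, forall m n, (N <= m)%N -> (N <= n)%N ->
       hdot (u m - u n) (u m - u n) <= e) ->
    exists l, forall e, 0 < e -> exists N, forall n, (N <= n)%N ->
       hdot (u n - l) (u n - l) <= e }.

Local Notation "''[' x , y ]" := (hdot x y) : ring_scope.
Local Notation "''[' x ]" := (hdot x x) : ring_scope.

Section InnerProduct.
Variables (R : realType) (V : realHilbert R).
Implicit Types (x y z : V) (T A B : V -> V).

Lemma hdotDr x y z : '[x, y + z] = '[x, y] + '[x, z].
Proof. by rewrite hdotC hdotDl !(hdotC x). Qed.

Lemma hdotZr a x y : '[x, a *: y] = a * '[x, y].
Proof. by rewrite hdotC hdotZl (hdotC x). Qed.

Lemma hdotNl x y : '[- x, y] = - '[x, y].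
Proof. by rewrite -scaleN1r hdotZl mulN1r. Qed.

Lemma hdotNr x y : '[x, - y] = - '[x, y].
Proof. by rewrite hdotC hdotNl (hdotC x). Qed.

Lemma hdot0l x : '[0, x] = 0.
Proof. by rewrite -(scale0r 0) hdotZl mul0r. Qed.

Lemma hdot0r x : '[x, 0] = 0.
Proof. by rewrite hdotC hdot0l. Qed.

Definition hdotE := (hdotDl, hdotDr, hdotNl, hdotNr, hdotZl, hdotZr,
  hdot0l, hdot0r).

Lemma hdot_ge0 x : 0 <= '[x].
Proof. by have [->|/hdot_gt0/ltW//] := eqVneq x 0; rewrite hdot0l. Qed.

Lemma hdot_eq0 x : '[x] = 0 -> x = 0.
Proof. by move=> x0; apply: contra_eq x0 => /hdot_gt0; rewrite lt0r => /andP[]. Qed.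

Lemma hdot_le0 x : '[x] <= 0 -> x = 0.
Proof. by move=> x0; apply/hdot_eq0/le_anti; rewrite x0 hdot_ge0. Qed.

Lemma hdot_ext x y : (forall z, '[x, z] = '[y, z]) -> x = y.
Proof.
by move=> xy; apply/eqP; rewrite -subr_eq0; apply/eqP/hdot_eq0; rewrite hdotDl hdotNl xy subrr.
Qed.

Lemma discriminant (a b c : R) :
  (forall t, 0 <= a + 2 * t * b + t ^+ 2 * c) -> b ^+ 2 <= a * c.
Proof.
move=> H; have a0 := H 0; rewrite !(mulr0, mul0r, expr0n, addr0) /= in a0.
have [c0|c0|c0] := ltgtP c 0.
- exfalso; have := H ((1 + a + 2 * `|b|) / - c + 1).
  set s := (1 + a + 2 * `|b|) / - c.
  have sc : s * c = - (1 + a + 2 * `|b|) by rewrite /s; field; rewrite lt_eqF.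
  have s0 : 0 <= s by rewrite /s divr_ge0 ?oppr_ge0 ?(ltW c0)// !addr_ge0 ?mulr_ge0.
  have nb : b <= `|b| by exact: ler_norm.
  have nbs : b * s <= `|b| * s by rewrite ler_wpM2r.
  have as0 : 0 <= a * s by rewrite mulr_ge0.
  have : (s + 1) ^+ 2 * c = - (1 + a + 2 * `|b|) * (s + 2) + c by rewrite -sc; ring.
  have n0 : 0 <= `|b| by [].
  by move: nb n0 nbs; set n := `|b|; move: s0 as0 a0 c0; clearbody n s; nra.
- have := H (- b / c).
  have -> : a + 2 * (- b / c) * b + (- b / c) ^+ 2 * c = (a * c - b ^+ 2) / c.
    by field; rewrite gt_eqF.
  by rewrite pmulr_lge0 ?invr_gt0// subr_ge0.
- rewrite c0 mulr0; have [->|b0] := eqVneq b 0; first by rewrite expr0n.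
  exfalso; have := H (- (1 + a) / b); rewrite c0 mulr0 addr0.
  have -> : 2 * (- (1 + a) / b) * b = - 2 * (1 + a) by field.
  lra.
Qed.


(** Operators are bare functions: having an adjoint already makes a function
    linear, as [adjD] and [adjZ] show. *)
Definition adjoint_pair T A := forall x y, '[T x, y] = '[x, A y].
Definition selfadj T := adjoint_pair T T.
Definition bounded_op T := exists2 C : R, 0 <= C & forall x, '[T x] <= C * '[x].

Lemma adjD T A : adjoint_pair T A -> {morph T : x y / x + y}.
Proof. by move=> TA x y; apply/hdot_ext => z; rewrite !(TA, hdotDl). Qed.

Lemma adjZ T A : adjoint_pair T A -> forall a, {morph T : x / a *: x}.
Proof. by move=> TA a x; apply/hdot_ext => z; rewrite !(TA, hdotZl). Qed.

Lemma adjN T A : adjoint_pair T A -> {morph T : x / - x}.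
Proof. by move=> TA x; rewrite -scaleN1r (adjZ TA) scaleN1r. Qed.

Lemma adj0 T A : adjoint_pair T A -> T 0 = 0.
Proof. by move=> TA; have := adjZ TA 0 0; rewrite !scale0r. Qed.

Lemma adjB T A : adjoint_pair T A -> {morph T : x y / x - y}.
Proof. by move=> TA x y; rewrite (adjD TA) (adjN TA). Qed.

Lemma le_of_sqr (r s : R) : 0 <= s -> r ^+ 2 <= s ^+ 2 -> r <= s.
Proof.
move=> s0 rs; apply: le_trans (ler_norm r) _.
by rewrite -(ler_pXn2r (n := 2))// ?nnegrE// real_normK ?num_real.
Qed.

(** The form of T needs to be non-negative only on the line through x in the
    direction y; this lets the inequality be used on subspaces where T is
    non-negative. *)
Lemma cauchy_schwarz_form T x y : selfadj T ->
    (forall t, 0 <= '[T (x + t *: y), x + t *: y]) ->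
  '[T x, y] ^+ 2 <= '[T x, x] * '[T y, y].
Proof.
move=> sT H; apply: discriminant => t; have := H t.
rewrite (adjD sT) (adjZ sT) !hdotE (hdotC (T y) x) -sT.
by congr (_ <= _); ring.
Qed.

Lemma cauchy_schwarz x y : '[x, y] ^+ 2 <= '[x] * '[y].
Proof. by apply: (@cauchy_schwarz_form id) => // t; exact: hdot_ge0. Qed.

Lemma hdotD_le x y : '[x + y] <= 2 * '[x] + 2 * '[y].
Proof.
have := hdot_ge0 (x - y); rewrite !hdotE (hdotC y x); lra.
Qed.

Lemma hdot_abs_le x y : `|'[x, y]| <= '[x] + '[y].
Proof.
have := hdot_ge0 (x - y); have := hdot_ge0 (x + y).
have := hdot_ge0 x; have := hdot_ge0 y.
by rewrite ler_norml !hdotE (hdotC y x); lra.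
Qed.

Lemma bounded_form T : bounded_op T ->
  exists2 C : R, 0 < C & forall x, `|'[T x, x]| <= C * '[x].
Proof.
move=> [C C0 HT]; exists (C + 1) => [|x]; first by rewrite ltr_pwDr.
by rewrite (le_trans (hdot_abs_le _ _))// mulrDl mul1r lerD2r.
Qed.

Lemma bounded_comp T A : bounded_op T -> bounded_op A -> bounded_op (T \o A).
Proof.
move=> [C C0 HT] [C' C'0 HA]; exists (C * C'); first exact: mulr_ge0.
by move=> x /=; rewrite (le_trans (HT _))// -mulrA ler_wpM2l.
Qed.

Lemma bounded_add T A : bounded_op T -> bounded_op A -> bounded_op (fun x => T x + A x).
Proof.
move=> [C C0 HT] [C' C'0 HA]; exists (2 * (C + C')); first by rewrite mulr_ge0 ?addr_ge0.
by move=> x /=; rewrite (le_trans (hdotD_le _ _))//; have := HT x; have := HA x; lra.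
Qed.

Lemma bounded_scale T a : bounded_op T -> bounded_op (fun x => a *: T x).
Proof.
move=> [C C0 HT]; exists (a ^+ 2 * C); first by rewrite mulr_ge0 ?sqr_ge0.
move=> x; rewrite hdotZl hdotZr mulrA -expr2 -(mulrA _ C) ler_wpM2l ?sqr_ge0//.
Qed.

Lemma bounded_id : bounded_op id.
Proof. by exists 1 => // x; rewrite mul1r. Qed.

(** * Properties that hold on a subspace of finite codimension *)
Definition perp (z : seq V) x := forall w, w \in z -> '[x, w] = 0.

Definition cofinite : set_system V := [set P | exists z : seq V, forall x, perp z x -> P x].

#[global] Instance cofinite_filter : Filter cofinite.
Proof.
split.
- by exists [::].
- move=> P Q [z Pz] [z' Qz']; exists (z ++ z') => x xz; split.
    by apply: Pz => w wz; apply: xz; rewrite mem_cat wz.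
  by apply: Qz' => w wz; apply: xz; rewrite mem_cat wz orbT.
- by move=> P Q PQ [z Pz]; exists z => x /Pz /PQ.
Qed.

(** T maps the orthogonal complement of the adjoint images of z into that of
    z. *)
Lemma cofinite_preim T A (P : set V) : adjoint_pair T A ->
  (\forall x \near cofinite, P x) -> \forall x \near cofinite, P (T x).
Proof.
move=> TA [z Pz]; exists (map A z) => x xz; apply: Pz => w wz.
by rewrite TA xz// map_f.
Qed.

(** For operators with an adjoint this is compactness.  Sums and compositions
    with bounded operators are immediate in this form. *)
Definition small_op T := forall e : R, 0 < e ->
  \forall x \near cofinite, '[T x] <= e * '[x].

Lemma small_compl T A : bounded_op T -> small_op A -> small_op (T \o A).
Proof.
move=> [C C0 HT] sA e e0; have e1 : 0 < e / (C + 1).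
  by rewrite divr_gt0// ltr_pwDr.
near=> x; rewrite /= (le_trans (HT _))//.
have Ax : '[A x] <= e / (C + 1) * '[x] by near: x; exact: sA.
rewrite (le_trans (ler_wpM2l C0 Ax))// mulrA ler_wpM2r ?hdot_ge0//.
by rewrite mulrCA ler_piMr ?(ltW e0)// ler_pdivrMr ?ltr_pwDr// mul1r lerDl.
Unshelve. all: end_near. Qed.

Lemma small_compr T T' A : adjoint_pair T T' -> bounded_op T -> small_op A ->
  small_op (A \o T).
Proof.
move=> TT' [C C0 HT] sA e e0; have e1 : 0 < e / (C + 1).
  by rewrite divr_gt0// ltr_pwDr.
near=> x; have Ax : '[A (T x)] <= e / (C + 1) * '[T x].
  by near: x; exact: (cofinite_preim TT' (sA _ e1)).
rewrite /= (le_trans Ax)// (le_trans (ler_wpM2l (ltW e1) (HT _)))// mulrA ler_wpM2r ?hdot_ge0//.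
by rewrite mulrAC -mulrA ler_piMr ?(ltW e0)// ler_pdivrMr ?ltr_pwDr// mul1r lerDl.
Unshelve. all: end_near. Qed.

Lemma small_add T A : small_op T -> small_op A -> small_op (fun x => T x + A x).
Proof.
move=> sT sA e e0; have e4 : 0 < e / 4 by rewrite divr_gt0.
near=> x; rewrite (le_trans (hdotD_le _ _))//.
have : '[T x] <= e / 4 * '[x] by near: x; exact: sT.
have : '[A x] <= e / 4 * '[x] by near: x; exact: sA.
have := hdot_ge0 x; lra.
Unshelve. all: end_near. Qed.

Lemma small_scale T a : small_op T -> small_op (fun x => a *: T x).
Proof.
move=> sT; apply: (@small_compl (fun x => a *: x)) => //.
exact: (@bounded_scale id _ bounded_id).
Qed.

End InnerProduct.

Section Eigenvectors.
Variables (R : realType) (V : realHilbert R).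
Implicit Types (x y z e w : V) (S T : V -> V) (Z M : set V).

(** * Eigenvectors of compact self-adjoint operators *)

(** Closed subspaces are given as orthogonal complements of arbitrary sets. *)
Definition orthocomp Z : set V := [set x | forall z, Z z -> '[x, z] = 0].

Lemma orthocompD Z x y : orthocomp Z x -> orthocomp Z y -> orthocomp Z (x + y).
Proof. by move=> Zx Zy z zZ; rewrite hdotDl Zx// Zy// addr0. Qed.

Lemma orthocompZ Z a x : orthocomp Z x -> orthocomp Z (a *: x).
Proof. by move=> Zx z zZ; rewrite hdotZl Zx// mulr0. Qed.

Lemma orthocompB Z x y : orthocomp Z x -> orthocomp Z y -> orthocomp Z (x - y).
Proof. by move=> Zx Zy; rewrite -scaleN1r; exact/orthocompD/orthocompZ. Qed.

Lemma hdot_limit (u : nat -> V) l w c :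
  (forall e : R, 0 < e -> exists N, forall n, (N <= n)%N -> '[u n - l] <= e) ->
  (forall n, '[u n, w] = c) -> '[l, w] = c.
Proof.
move=> ul uc; apply/eqP; rewrite -subr_eq0 -sqrf_eq0; apply/eqP/le_anti.
rewrite sqr_ge0 andbT; apply/ler_addgt0Pr => e e0; rewrite add0r.
have e1 : 0 < e / ('[w] + 1) by rewrite divr_gt0// ltr_pwDr ?hdot_ge0.
have [N /(_ N (leqnn N)) uN] := ul _ e1.
have -> : ('[l, w] - c) ^+ 2 = '[u N - l, w] ^+ 2.
  by rewrite hdotDl hdotNl uc; ring.
rewrite (le_trans (cauchy_schwarz _ _))//.
rewrite (le_trans (ler_wpM2r (hdot_ge0 w) uN))//.
by rewrite mulrAC -mulrA ler_piMr ?(ltW e0)// ler_pdivrMr ?ltr_pwDr ?hdot_ge0// mul1r lerDl.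
Qed.

(** By the Cauchy-Schwarz inequality of the form of S, applied to x and S x. *)
Lemma form_zero S Z x : selfadj S -> (forall y, orthocomp Z y -> orthocomp Z (S y)) ->
  (forall y, orthocomp Z y -> 0 <= '[S y, y]) ->
  orthocomp Z x -> '[S x, x] = 0 -> S x = 0.
Proof.
move=> sS ZS S0 Zx Sxx; apply/hdot_eq0/eqP; rewrite -sqrf_eq0; apply/eqP/le_anti.
rewrite sqr_ge0 andbT.
rewrite -[leRHS](mul0r '[S (S x), S x]) -Sxx; apply: cauchy_schwarz_form => // t.
by apply/S0/orthocompD => //; apply/orthocompZ/ZS.
Qed.

Definition coercive_on S (M : set V) :=
  exists2 k : R, 0 < k & forall x, M x -> k * '[x] <= '[S x, x].

(** Dropping one linear constraint w.  If the infimum m of the form of S on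
    the affine slice where the product with w is 1 is positive, then S is
    coercive on the whole subspace.  If m = 0, coercivity in the directions
    orthogonal to w makes a minimizing sequence Cauchy, and its limit is a
    null vector of the form. *)
Lemma coercive_or_kernel1 S Z w : selfadj S -> bounded_op S ->
  (forall x, orthocomp Z x -> 0 <= '[S x, x]) ->
  coercive_on S [set x | orthocomp Z x /\ '[x, w] = 0] ->
  coercive_on S (orthocomp Z) \/
  exists e, [/\ orthocomp Z e, e != 0 & '[S e, e] = 0].
Proof.
move=> sS bS S0 [k k0 Hk].
have [w0|] := pselect (forall x, orthocomp Z x -> '[x, w] = 0).
  by left; exists k => // x Zx; apply: Hk; split => //; exact: w0.
move=> /existsNP[e' /not_implyP[Ze' /eqP e'w]].
pose e := '[e', w]^-1 *: e'.
have Ze : orthocomp Z e by exact: orthocompZ.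
have ew : '[e, w] = 1 by rewrite hdotZl mulVf.
have par x y : orthocomp Z x -> orthocomp Z y ->
    '[S (x - y), x - y] <= 2 * '[S x, x] + 2 * '[S y, y].
  move=> Zx Zy; have := S0 _ (orthocompD Zx Zy).
  rewrite (adjB sS) (adjD sS) !hdotE (hdotC (S y) x) (sS x y); lra.
have [[m m0 Hm]|] := pselect (exists2 m : R, 0 < m & forall x, orthocomp Z x -> '[x, w] = 1 -> m <= '[S x, x]).
  left; pose c := 2 + 2 * '[S e, e] / m.
  have c0 : 0 < c by rewrite /c ltr_pwDl// divr_ge0 ?(ltW m0)// mulr_ge0// S0.
  have Se0 := S0 _ Ze.
  pose C := 2 * c / k + 2 * '[e] / m.
  have C0 : 0 < C.
    by rewrite /C ltr_pwDl// ?divr_gt0 ?divr_ge0 ?mulr_gt0 ?mulr_ge0 ?hdot_ge0 ?ltW.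
  exists C^-1; first by rewrite invr_gt0.
  move=> x Zx; rewrite mulrC ler_pdivrMr//.
  pose s := '[x, w].
  have Hs : m * s ^+ 2 <= '[S x, x].
    have [s0|s0] := eqVneq s 0; first by rewrite s0 expr0n mulr0 S0.
    have := Hm (s^-1 *: x) (orthocompZ _ Zx); rewrite hdotZl mulVf// => /(_ erefl).
    rewrite (adjZ sS) hdotZl hdotZr mulrA -expr2 exprVn mulrC ler_pdivlMr//.
    by rewrite lt_def sqrf_eq0 s0 sqr_ge0.
  have xse : orthocomp Z (s *: e) by exact: orthocompZ.
  have H1 : k * '[x - s *: e] <= '[S (x - s *: e), x - s *: e].
    apply: Hk; split; first exact: orthocompB.
    by rewrite hdotDl hdotNl hdotZl ew mulr1 subrr.
  have H2 := par x (s *: e) Zx xse.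
  have H3 : '[S (s *: e), s *: e] = s ^+ 2 * '[S e, e].
    by rewrite (adjZ sS) hdotZl hdotZr mulrA expr2.
  have H4 : '[x] <= 2 * '[x - s *: e] + 2 * '[s *: e].
    by have := hdotD_le (x - s *: e) (s *: e); rewrite subrK.
  have H5 : '[s *: e] = s ^+ 2 * '[e] by rewrite hdotZl hdotZr mulrA expr2.
  have s2 : s ^+ 2 <= '[S x, x] / m by rewrite ler_pdivlMr// mulrC.
  have H6 : '[S (x - s *: e), x - s *: e] <= c * '[S x, x].
    have H6 : s ^+ 2 * '[S e, e] <= '[S e, e] / m * '[S x, x].
      by rewrite mulrC mulrAC -mulrA ler_wpM2l.
    apply: le_trans H2 _; rewrite H3 /c -mulrA; lra.
  have H7 : '[x - s *: e] <= c / k * '[S x, x].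
    by rewrite mulrAC ler_pdivlMr// mulrC; exact: le_trans H1 H6.
  apply: le_trans H4 _; rewrite H5.
  have : s ^+ 2 * '[e] <= '[e] / m * '[S x, x].
    by rewrite mulrC mulrAC -mulrA ler_wpM2l ?hdot_ge0.
  rewrite /C; move: H7; set X := '[S x, x]; set Y := '[x - _].
  have -> : 2 * c / k = 2 * (c / k) by rewrite mulrA.
  have -> : 2 * '[e] / m = 2 * ('[e] / m) by rewrite mulrA.
  lra.
move=> nm; right.
have : forall n, exists x, [/\ orthocomp Z x, '[x, w] = 1 & '[S x, x] <= n.+1%:R^-1].
  move=> n; apply: contrapT => nx; apply: nm; exists n.+1%:R^-1; first by rewrite invr_gt0.
  move=> x Zx xw; rewrite leNgt; apply/negP => xn; apply: nx; exists x; split => //.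
  exact: ltW.
move=> /choice[u Hu].
have smalln (d : R) : 0 < d -> exists N, forall n, (N <= n)%N -> n.+1%:R^-1 <= d.
  move=> d0; have [N _ HN] := near_infty_natSinv_lt (PosNum d0).
  by exists N => n Nn; apply/ltW/(HN n).
have [|l ul] := @hcomplete _ V u.
  move=> d d0; have [|N HN] := smalln (k * d / 4); first by rewrite divr_gt0 ?mulr_gt0.
  exists N => m n Nm Nn; have [Zm mw Sm] := Hu m; have [Zn nw Sn] := Hu n.
  have H1 : k * '[u m - u n] <= '[S (u m - u n), u m - u n].
    apply: Hk; split; first exact: orthocompB.
    by rewrite hdotDl hdotNl mw nw subrr.
  have H2 := par _ _ Zm Zn; have := HN _ Nm; have := HN _ Nn => H3 H4.
  rewrite -(ler_pM2l k0); apply: (le_trans H1); apply: (le_trans H2).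
  have := le_trans Sm H4; have := le_trans Sn H3; lra.
have Zl : orthocomp Z l.
  by move=> z zZ; apply: (hdot_limit ul) => n; have [/(_ z zZ)] := Hu n.
exists l; split => //.
  apply/eqP => l0; have : '[l, w] = 1.
    by apply: (hdot_limit ul) => n; have [] := Hu n.
  by rewrite l0 hdot0l => /esym/eqP; rewrite oner_eq0.
apply/le_anti; rewrite S0// andbT; apply/ler_addgt0Pr => d d0; rewrite add0r.
have [C C0 HC] := bounded_form bS.
have d1 : 0 < d / (4 * C) by rewrite divr_gt0// mulr_gt0.
have [N1 HN1] := ul _ d1.
have [|N2 HN2] := smalln (d / 4); first by rewrite divr_gt0.
pose n := maxn N1 N2; have [Zn nw Sn] := Hu n.
have := HN2 n (leq_maxr _ _); have := HN1 n (leq_maxl _ _).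
have := par (u n) (u n - l) Zn (orthocompB Zn Zl).
have -> : u n - (u n - l) = l by rewrite opprB addrCA subrr addr0.
have := le_trans (ler_norm _) (HC (u n - l)).
move=> H1 H2 H3 H4.
have H5 : C * '[u n - l] <= d / 4.
  rewrite mulrC -ler_pdivlMr// (le_trans H3)//.
  by rewrite -mulrA -invfM.
apply: le_trans H2 _.
have := le_trans H1 H5; have := le_trans Sn H4; lra.
Qed.

Lemma coercive_or_kernel S (z : seq V) Z : selfadj S -> bounded_op S ->
  (forall x, orthocomp Z x -> 0 <= '[S x, x]) ->
  coercive_on S [set x | orthocomp Z x /\ perp z x] ->
  coercive_on S (orthocomp Z) \/
  exists e, [/\ orthocomp Z e, e != 0 & '[S e, e] = 0].
Proof.
move=> sS bS; elim: z Z => [|w z IHz] Z S0 [k k0 Hk].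
  by left; exists k => // x Zx; exact: Hk.
pose Z' := [set y | Z y \/ y = w].
have Z'E x : orthocomp Z' x <-> orthocomp Z x /\ '[x, w] = 0.
  split=> [H|[Zx xw] y [/Zx//|->//]].
  by split=> [y Zy|]; apply: H; [left|right].
case: (IHz Z').
- by move=> x /Z'E[Zx _]; exact: S0.
- exists k => // x [/Z'E[Zx xw] xz]; apply: Hk; split => // y.
  by rewrite inE => /orP[/eqP->//|/xz].
- move=> [k' k'0 Hk']; apply: (@coercive_or_kernel1 S Z w) => //.
  by exists k' => // x /Z'E; exact: Hk'.
- by move=> [e [/Z'E[Ze _] e0 Se]]; right; exists e.
Qed.

(** Let mu < 0 be the infimum of the Rayleigh quotient of S.  Then S - mu is
    non-negative, not coercive, and coercive under finitely many additional
    constraints because S is small there; so its form has a null vector, which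
    is an eigenvector for mu. *)
Lemma negative_eigenvector S Z x0 : selfadj S -> bounded_op S -> small_op S ->
  (forall x, orthocomp Z x -> orthocomp Z (S x)) ->
  orthocomp Z x0 -> '[S x0, x0] < 0 ->
  exists e (l : R), [/\ orthocomp Z e, e != 0, l < 0 & S e = l *: e].
Proof.
move=> sS bS smS ZS Zx0 Sx0; have [C C0 HC] := bounded_form bS.
pose Q := [set r : R | exists x, [/\ orthocomp Z x, x != 0 & r = '[S x, x] / '[x]]].
have Qlb : lbound Q (- C).
  move=> _ [x [_ xn0 ->]]; rewrite ler_pdivlMr ?hdot_gt0//.
  by have := HC x; rewrite ler_norml mulNr => /andP[].
have x0n0 : x0 != 0 by apply: contraTneq Sx0 => ->; rewrite hdot0r ltxx.
have Qx0 : Q ('[S x0, x0] / '[x0]) by exists x0.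
have hQ : has_inf Q by split; [exists ('[S x0, x0] / '[x0]) | exists (- C)].
pose mu := inf Q.
have mu0 : mu < 0.
  apply: (@le_lt_trans _ _ ('[S x0, x0] / '[x0])); first exact: (ge_inf hQ.2).
  by rewrite pmulr_llt0 ?invr_gt0 ?hdot_gt0.
pose T x := S x - mu *: x.
have sT : selfadj T.
  by move=> x y; rewrite /T !hdotE sS.
have TE x : '[T x, x] = '[S x, x] - mu * '[x] by rewrite /T !hdotE.
have T0 x : orthocomp Z x -> 0 <= '[T x, x].
  move=> Zx; rewrite TE subr_ge0; have [->|xn0] := eqVneq x 0.
    by rewrite !hdot0r mulr0.
  by rewrite -ler_pdivlMr ?hdot_gt0//; apply: (ge_inf hQ.2); exists x.
have bT : bounded_op T.
  have -> : T = (fun x => S x + (- mu) *: id x).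
    by apply: funext => x; rewrite /T -scaleNr.
  by apply: bounded_add => //; apply: bounded_scale; exact: bounded_id.
have e0 : 0 < (mu / 2) ^+ 2 by rewrite exprn_even_gt0//= mulf_eq0 invr_eq0 negb_or lt_eqF//= pnatr_eq0.
have [z Hz] := smS _ e0.
have [||[k k0 Hk]|[e [Ze en0 Te]]] := @coercive_or_kernel T z Z sT bT.
- exact: T0.
- exists (- mu / 2); first by rewrite divr_gt0 ?oppr_gt0.
  move=> x [Zx /Hz Sx]; rewrite TE.
  suff : `|'[S x, x]| <= - mu / 2 * '[x] by rewrite ler_norml => /andP[+ _]; lra.
  have xx0 := hdot_ge0 x.
  have H0 : 0 <= - mu / 2 * '[x] by rewrite mulr_ge0// divr_ge0// oppr_ge0 ltW.
  rewrite -(ler_pXn2r (n := 2))// ?nnegrE// real_normK ?num_real//.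
  rewrite (le_trans (cauchy_schwarz _ _))// (le_trans (ler_wpM2r xx0 Sx))//.
  by rewrite le_eqVlt; apply/orP; left; apply/eqP; field.
- exfalso.
  have [r [x [Zx xn0 ->]]] := inf_adherent k0 hQ; rewrite -/mu ltNge => /negP; apply.
  rewrite ler_pdivlMr ?hdot_gt0// mulrDl; have := Hk _ Zx; rewrite TE; lra.
- exists e, mu; split => //.
  have : T e = 0.
    apply: (@form_zero T Z) => // y Zy.
    by apply: orthocompB; [exact: ZS|exact: orthocompZ].
  by move/eqP; rewrite subr_eq0 => /eqP.
Qed.


(** Each negative eigenvector e found in the orthogonal complement of f uses up
    one of the constraints z: some w in z has a non-zero product with e, and
    subtracting multiples of w from the other constraints makes them
    orthogonal to e.  A vector that satisfies the new constraints then becomes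
    orthogonal to all of z after adding a multiple of e, which only decreases
    the form of S. *)
Lemma finitely_many_negative S (z : seq V) (f : seq V) :
    selfadj S -> bounded_op S -> small_op S ->
    (forall v, v \in f -> exists l : R, S v = l *: v) ->
    (forall x, perp f x -> perp z x -> 0 <= '[S x, x]) ->
  exists f' : seq V, (forall v, v \in f' -> exists l : R, S v = l *: v) /\
    (forall x, perp f' x -> 0 <= '[S x, x]).
Proof.
move=> sS bS smS; have [n] := ubnP (size z); elim: n z f => // n IHn z f zn fS Hz.
have [H|] := pselect (forall x, perp f x -> 0 <= '[S x, x]); first by exists f.
move=> /existsNP[x0 /not_implyP[fx0 /negP]]; rewrite -ltNge => Sx0.
have [|||e [l [fe e0 l0 Se]]] := @negative_eigenvector S [set` f] x0 sS bS smS.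
- by move=> x fx y fy; have [c Sy] := fS _ fy; rewrite sS Sy hdotZr fx// mulr0.
- exact: fx0.
- exact: Sx0.
have [w wz ew] : exists2 w, w \in z & '[e, w] != 0.
  apply: contrapT => H; suff : 0 <= '[S e, e].
    by rewrite Se hdotZl pmulr_lge0 ?hdot_gt0// leNgt l0.
  apply: Hz => // w wz; apply: contrapT => /eqP ew; apply: H; by exists w.
pose c v := '[e, v] / '[e, w].
apply: (IHn [seq v - c v *: w | v <- rem w z] (e :: f)).
- by rewrite size_map size_rem//; case: (z) wz zn => //= ? ?.
- by move=> v; rewrite inE => /orP[/eqP->|/fS//]; exists l.
move=> x xef xz.
have xe : '[x, e] = 0 by apply: xef; rewrite mem_head.
have xf : perp f x by move=> v vf; apply: xef; rewrite inE vf orbT.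
pose t := - '[x, w] / '[e, w].
have xtw : '[x + t *: e, w] = 0.
  by rewrite hdotDl hdotZl /t divfK// subrr.
have : 0 <= '[S (x + t *: e), x + t *: e].
  apply: Hz.
    by move=> v vf; rewrite hdotDl hdotZl xf// fe// mulr0 addr0.
  move=> v; rewrite (perm_mem (perm_to_rem wz)) inE => /orP[/eqP->//|vz].
  have := xz _ (map_f _ vz); rewrite !hdotE => H.
  have cv : c v * '[e, w] = '[e, v] by rewrite /c divfK.
  have cw : t * '[e, w] = - '[x, w] by rewrite /t divfK.
  by rewrite -cv mulrCA cw mulrN.
rewrite (adjD sS) (adjZ sS) Se !hdotE (sS x e) Se !hdotE xe (hdotC e x) xe.
have e1 := hdot_gt0 e0.
have : t * (t * (l * '[e])) <= 0.
  by rewrite mulrA -expr2 mulr_ge0_le0 ?sqr_ge0// mulr_le0_ge0 ?(ltW l0)// ltW.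
rewrite !(mulr0, addr0, add0r); lra.
Qed.

(** Let f be a finite list of eigenvectors of S such that S >= 0 on its
    orthogonal complement.  Consider the vectors orthogonal to f, to W f and to
    the kernel of W.  They form an S-invariant subspace; an eigenvector of S
    with positive eigenvalue in it would be mapped by W to an eigenvector with
    negative eigenvalue orthogonal to f, hence to 0, and so would lie both in
    the kernel of W and in its orthogonal complement.  Thus S = 0 on that
    subspace.  As W is skew, it contains W x for all x orthogonal to W f and to
    W W f. *)
Lemma anticommuting_nonneg_small S W : selfadj S -> bounded_op S -> small_op S ->
    adjoint_pair W (fun x => - W x) -> (forall x, S (W x) = - W (S x)) ->
    (\forall x \near @cofinite R V, 0 <= '[S x, x]) ->
  \forall x \near @cofinite R V, S (W x) = 0.
Proof.
move=> sS bS smS skW SW [z Hz].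
have [||f [fS fS0]] := @finitely_many_negative S z [::] sS bS smS.
- by [].
- by move=> x _; exact: Hz.
have skW' x y : '[x, W y] = - '[W x, y] by rewrite skW hdotNr opprK.
pose Z := [set y | y \in f \/ (exists2 v, v \in f & y = W v) \/ W y = 0].
have ZS x : orthocomp Z x -> orthocomp Z (S x).
  move=> Zx y [yf|[[v vf ->]|Wy]].
  - by have [l Sy] := fS _ yf; rewrite sS Sy hdotZr Zx ?mulr0//; left.
  - have [l Sv] := fS _ vf; rewrite sS SW Sv (adjZ skW) hdotNr hdotZr Zx ?mulr0 ?oppr0//.
    by right; left; exists v.
  - by rewrite sS; apply: Zx; right; right; apply: oppr_inj; rewrite -SW Wy (adj0 sS) oppr0.
have Zf x : orthocomp Z x -> perp f x by move=> Zx y yf; apply: Zx; left.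
have Z0 x : orthocomp Z x -> '[S x, x] = 0.
  move=> Zx; apply/le_anti; rewrite fS0 ?andbT; last exact: Zf.
  rewrite leNgt; apply/negP => Sx.
  pose S' y := - S y.
  have sS' : selfadj S' by move=> u v; rewrite /S' !hdotE sS.
  have bS' : bounded_op S'.
    by have [C C0 HC] := bS; exists C => // y; rewrite /S' !hdotE opprK.
  have smS' : small_op S'.
    by move=> d /smS; apply: filterS => y; rewrite /S' !hdotE opprK.
  have [|||e [l [Ze e0 l0 Se]]] := @negative_eigenvector S' Z x sS' bS' smS'.
  - by move=> y Zy; rewrite /S' -scaleN1r; apply/orthocompZ/ZS.
  - exact: Zx.
  - by rewrite /S' hdotNl oppr_lt0.
  have SWe : S (W e) = l *: W e by rewrite SW -(adjN skW) -(adjZ skW) -Se.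
  have We : W e = 0.
    apply: hdot_le0; have : 0 <= '[S (W e), W e].
      apply: fS0 => v vf; rewrite skW hdotNr Ze ?oppr0//.
      by right; left; exists v.
    by rewrite SWe hdotZl nmulr_rge0.
  by move/eqP: e0; apply; apply/hdot_eq0/Ze; right; right.
exists (map W f ++ map W (map W f)) => x xz.
have Wf v : v \in f -> '[x, W v] = 0.
  by move=> vf; apply: xz; rewrite mem_cat map_f.
have WWf v : v \in f -> '[x, W (W v)] = 0.
  by move=> vf; apply: xz; rewrite mem_cat (map_f W (map_f W vf)) orbT.
have ZWx : orthocomp Z (W x).
  move=> y [yf|[[v vf ->]|Wy]]; rewrite skW hdotNr.
  - by rewrite Wf// oppr0.
  - by rewrite WWf// oppr0.
  - by rewrite Wy hdot0r oppr0.
by apply: (form_zero sS ZS _ ZWx (Z0 _ ZWx)) => y Zy; rewrite Z0.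
Qed.

End Eigenvectors.

(** * Polynomials in a self-adjoint operator, as products of linear factors *)
Section LinearFactors.
Variables (R : realType) (V : realHilbert R) (D : V -> V).
Hypotheses (sD : selfadj D) (bD : bounded_op D).
Implicit Types (x y : V) (rs : seq R).

Definition factors rs x := foldr (fun r y => D y - r *: y) x rs.

Lemma factors_cat rs rs' x : factors (rs ++ rs') x = factors rs (factors rs' x).
Proof. by rewrite /factors foldr_cat. Qed.

Lemma factors_comm (T T' : V -> V) rs x : adjoint_pair T T' ->
  (forall y, T (D y) = D (T y)) -> factors rs (T x) = T (factors rs x).
Proof.
move=> TT' TD; elim: rs => //= r rs ->.
by rewrite (adjB TT') (adjZ TT') TD.
Qed.

Lemma selfadj_factors rs : selfadj (factors rs).
Proof.
elim: rs => // r rs IH x y /=.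
by rewrite !hdotE sD !IH (factors_comm _ _ sD).
Qed.

Lemma bounded_factors rs : bounded_op (factors rs).
Proof.
elim: rs => [|r rs IH]; first exact: bounded_id.
have -> : factors (r :: rs) = (fun x => (D \o factors rs) x + (- r) *: factors rs x).
  by apply: funext => x; rewrite /= scaleNr.
by apply: bounded_add; [exact: bounded_comp|exact: bounded_scale].
Qed.

Lemma factors_catC rs rs' x : factors (rs ++ rs') x = factors (rs' ++ rs) x.
Proof.
rewrite !factors_cat (factors_comm _ _ (selfadj_factors rs'))// => y.
by rewrite (factors_comm _ _ sD).
Qed.

Lemma factors_anticomm W W' rs x : adjoint_pair W W' ->
  (forall y, D (W y) = - W (D y)) ->
  factors rs (W x) = (-1) ^+ size rs *: W (factors (map -%R rs) x).
Proof.
move=> WW' DW; elim: rs => [|r rs IH] /=; first by rewrite scale1r.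
rewrite IH (adjZ sD) DW (adjB WW') (adjZ WW') exprS.
by apply: hdot_ext => z; rewrite !hdotE; ring.
Qed.

Lemma small_factors rs rs' rs'' : small_op (factors rs) ->
  small_op (factors (rs' ++ rs ++ rs'')).
Proof.
move=> sm; have -> : factors (rs' ++ rs ++ rs'') =
    factors rs' \o (factors rs \o factors rs'').
  by apply: funext => x; rewrite /= !factors_cat.
apply: small_compl; first exact: bounded_factors.
by apply: (small_compr (selfadj_factors rs'')) => //; exact: bounded_factors.
Qed.

(** Multiplying D - r by D - (a + c - r) gives G - g for a scalar g, where
    G = (D - a)(D - c).  So some product of factors G - g vanishes on a subspace
    of finite codimension.  There a factor with g <> 0 can be removed because G
    is small, and what remains is a power of G, which has the kernel of G as G
    is self-adjoint. *)
Lemma finite_rank_of_factors a c rs : small_op (factors [:: a; c]) ->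
  (\forall x \near @cofinite R V, factors rs x = 0) ->
  \forall x \near @cofinite R V, factors [:: a; c] x = 0.
Proof.
set G := factors [:: a; c] => sG; have adG : selfadj G by exact: selfadj_factors.
have GD y : G (D y) = D (G y) by exact: (factors_comm _ _ sD).
have aGk k : selfadj (iter k G).
  elim: k => // k IH x y; rewrite iterS adG IH -iterSr //.
have kill k : (\forall x \near @cofinite R V, iter k.+1 G x = 0) ->
    \forall x \near @cofinite R V, G x = 0.
  elim: k => // k IH H; apply: IH; near=> x; apply: hdot_eq0.
  rewrite {1}iterS adG (_ : G (iter k.+1 G x) = 0) ?hdot0r//.
  by near: x; exact: H.
suff H k : (\forall x \near @cofinite R V, factors rs (iter k G x) = 0) ->
    exists k, \forall x \near @cofinite R V, iter k.+1 G x = 0.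
  by move=> /(H 0)[k] /kill.
elim: rs k => [|r rs IH] k Hk.
  exists k; near=> x; rewrite iterS (_ : iter k G x = 0) ?(adj0 adG)//.
  by near: x; exact: Hk.
pose y x := factors rs (iter k G x).
have sy : adjoint_pair y (fun x => iter k G (factors rs x)).
  by move=> x z; rewrite /y selfadj_factors aGk.
(* This is the value at r of the monic polynomial with roots a and c. *)
pose g := a * c - r * (a + c - r).
have Gy : \forall x \near @cofinite R V, G (y x) = g *: y x.
  near=> x; have /eqP : D (y x) - r *: y x = 0 by near: x; exact: Hk.
  rewrite subr_eq0 => /eqP Dy; rewrite /G /= !(Dy, adjB sD, adjZ sD, scalerBr, scalerA).
  apply: hdot_ext => z; rewrite /g !hdotE; ring.
have [g0|g0] := eqVneq g 0.
  apply: (IH k.+1); near=> x; rewrite iterS (factors_comm _ _ adG) ?GD//.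
  by rewrite -/(y x) (near Gy x)// g0 scale0r.
apply: (IH k).
have g2 : 0 < g ^+ 2 / 2 by rewrite divr_gt0// lt_def sqrf_eq0 g0 sqr_ge0.
have Hs := cofinite_preim sy (sG _ g2).
near=> x; apply: hdot_le0.
have : '[G (y x)] <= g ^+ 2 / 2 * '[y x] by near: x; exact: Hs.
rewrite (near Gy x)// !hdotE -/(y x) mulrA -expr2.
have g2' : 0 < g ^+ 2 by rewrite lt_def sqrf_eq0 g0 sqr_ge0.
by move=> H0; rewrite -(pmulr_rle0 _ g2'); lra.
Unshelve. all: end_near. Qed.

End LinearFactors.

(** * The choice of the odd cubic *)
Section RealInequalities.
Variable R : realType.

Lemma threshold (A A' N : R) : 0 < A ->
  exists2 e0, 0 < e0 & forall e, 0 < e -> e <= e0 -> N <= A / e + A' - e.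
Proof.
move=> A0; pose M := `|N| + `|A'| + 1.
have M0 : 0 < M by rewrite /M ltr_pwDr// addr_ge0.
exists (Num.min 1 (A / M)); first by rewrite lt_min ltr01 divr_gt0.
move=> e e0; rewrite le_min => /andP[e1]; rewrite ler_pdivlMr// => eM.
have : M <= A / e by rewrite ler_pdivlMr// mulrC.
have := ler_norm N; have := ler_norm (- A'); rewrite normrN /M; lra.
Qed.

Lemma form2_nonneg (m n G p q r : R) : 0 <= m -> 0 <= n -> G ^+ 2 <= m * n ->
  0 <= p -> 0 <= q -> r ^+ 2 <= p * q -> 0 <= m * p + n * q + 2 * G * r.
Proof.
move=> m0 n0 Gmn p0 q0 rpq.
have H : (2 * G * r) ^+ 2 <= (m * p + n * q) ^+ 2.
  have : G ^+ 2 * r ^+ 2 <= (m * n) * (p * q) by rewrite ler_pM ?sqr_ge0.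
  have := sqr_ge0 (m * p - n * q); nra.
have S0 : 0 <= m * p + n * q by rewrite addr_ge0// mulr_ge0.
have : `|2 * G * r| <= m * p + n * q.
  by rewrite -(ler_pXn2r (n := 2))// ?nnegrE// real_normK ?num_real.
rewrite ler_norml => /andP[+ _]; lra.
Qed.

(** For a value A and a slope A' at a point: the function is positive at the
    point and immediately to its right, or vanishes there and increases. *)
Definition positive_right (A A' : R) := 0 < A \/ A = 0 /\ 0 < A'.

(** The binary quadratic form with diagonal coefficients A / e + A' - e and
    B / e + B' - e and off-diagonal coefficient G is non-negative when e is
    small.  The terms A / e and B / e come from replacing
    squared norms by the much smaller values of a compact form. *)
Lemma two_level_threshold (A A' B B' G : R) :
  positive_right A A' -> positive_right B B' -> (A = 0 -> B = 0 -> G = 0) ->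
  exists2 e, 0 < e & [/\ 0 <= A / e + A' - e, 0 <= B / e + B' - e &
    G ^+ 2 <= (A / e + A' - e) * (B / e + B' - e)].
Proof.
have prod (m n x y : R) : 0 <= x -> 0 <= y -> x <= m -> y <= n -> G ^+ 2 <= x * y ->
   [/\ 0 <= m, 0 <= n & G ^+ 2 <= m * n].
  move=> x0 y0 xm yn H; split; [exact: le_trans xm|exact: le_trans yn|].
  by apply: le_trans H _; exact: ler_pM.
have one (X X' Y Y' : R) : 0 < X -> Y = 0 -> 0 < Y' -> exists2 e, 0 < e &
   [/\ 0 <= X / e + X' - e, 0 <= Y / e + Y' - e &
    G ^+ 2 <= (X / e + X' - e) * (Y / e + Y' - e)].
  move=> X0 -> Y'0; have [e0 e00 He0] := threshold X' (G ^+ 2 / (Y' / 2)) X0.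
  have e0' : 0 < Num.min e0 (Y' / 2) by rewrite lt_min e00 divr_gt0.
  exists (Num.min e0 (Y' / 2)) => //.
  apply: (prod _ _ (G ^+ 2 / (Y' / 2)) (Y' / 2)).
  - by rewrite divr_ge0 ?sqr_ge0 ?divr_ge0 ?ltW.
  - by rewrite divr_ge0 ?ltW.
  - by apply: He0 => //; rewrite ge_min lexx.
  - have : Num.min e0 (Y' / 2) <= Y' / 2 by rewrite ge_min lexx orbT.
    by rewrite mul0r; lra.
  - by rewrite divfK// mulf_neq0 ?gt_eqF ?invr_gt0.
move=> [A0|[A0 A'0]] [B0|[B0 B'0]] HG.
- have [e1 e10 He1] := threshold A' `|G| A0.
  have [e2 e20 He2] := threshold B' `|G| B0.
  have e0 : 0 < Num.min e1 e2 by rewrite lt_min e10.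
  exists (Num.min e1 e2) => //; apply: (prod _ _ `|G| `|G|) => //.
  - by apply: He1 => //; rewrite ge_min lexx.
  - by apply: He2 => //; rewrite ge_min lexx orbT.
  - by rewrite -expr2 real_normK ?num_real.
- exact: one.
- have [e e0 [H1 H2 H3]] := one B B' A A' B0 A0 A'0.
  by exists e => //; split => //; rewrite mulrC.
- have e0 : 0 < Num.min A' B' by rewrite lt_min A'0.
  exists (Num.min A' B') => //; rewrite HG// A0 B0 !mul0r !add0r.
  have [H1 H2] : 0 <= A' - Num.min A' B' /\ 0 <= B' - Num.min A' B'.
    by rewrite !subr_ge0 !ge_min !lexx orbT.
  by split => //; rewrite expr0n mulr_ge0.
Qed.

(** The cubic is al X + be X^3, and the last condition concerns its divided
    difference between a and c.  With d = (a + c)/2 and h = (a - c)/2, it is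
    - X if a and c are negative.  Otherwise exactly one of a and c is negative,
    and the cubic is X^3 - h^2 X, or its opposite if d < 0, because the values
    of X^3 - h^2 X at d + h and d - h are d (d + h)(d + 2h) and
    d (d - h)(d - 2h).  For d = 0 both vanish, together with the divided
    difference, and the slopes are positive.  If d < 0 and a or c is 0, then
    the value there is 0 and the slope is h^2. *)
Lemma odd_cubic_exists (a c : R) : ~ (0 <= a /\ 0 <= c) ->
  exists al be : R, [/\ (be = 0 /\ al != 0) \/ (be != 0 /\ al = - be * ((a - c) / 2) ^+ 2),
    positive_right (al * c + be * c ^+ 3) (al + 3 * be * c ^+ 2),
    positive_right (al * a + be * a ^+ 3) (al + 3 * be * a ^+ 2) &
    (al * c + be * c ^+ 3 = 0 -> al * a + be * a ^+ 3 = 0 ->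
      al + be * (a ^+ 2 + a * c + c ^+ 2) = 0)].
Proof.
wlog ac : a c / c <= a.
  move=> H nac; have [ac|/ltW ca] := leP c a; first exact: H.
  have [|al [be [H1 H2 H3 H4]]] := H _ _ ca; first by move=> [? ?]; apply: nac.
  exists al, be; split => //.
    by case: H1 => [?|[? ->]]; [left|right; split => //; field].
  by move=> E1 E2; rewrite -[RHS](H4 E2 E1); ring.
move=> nac; have c0 : c < 0.
  by rewrite ltNge; apply/negP => c0; apply: nac; split => //; exact: le_trans ac.
have [a0|a0] := ltP a 0.
  exists (-1), 0; split.
  - by left; split => //; rewrite oppr_eq0 oner_eq0.
  - by left; lra.
  - by left; lra.
  - by lra.
pose d := (a + c) / 2; pose h := (a - c) / 2.
have aE : a = d + h by rewrite /d /h; field.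
have cE : c = d - h by rewrite /d /h; field.
have h0 : 0 < h by rewrite /h; lra.
have [d0|d0|d0] := ltgtP d 0.
- exists (h ^+ 2), (-1); split.
  + by right; split; [rewrite oppr_eq0 oner_eq0|rewrite -/h; ring].
  + left; have -> : h ^+ 2 * c + -1 * c ^+ 3 = (- c) * ((- d) * (2 * h - d)).
      by rewrite cE; ring.
    by rewrite !mulr_gt0//; lra.
  + have E : h ^+ 2 * a + -1 * a ^+ 3 = a * ((- d) * (d + 2 * h)).
      by rewrite aE; ring.
    move: a0; rewrite le_eqVlt => /predU1P[a0|a0]; last first.
      by left; rewrite E !mulr_gt0//; lra.
    right; rewrite -a0; split; first by ring.
    by rewrite expr0n/= mulr0 addr0 exprn_gt0.
  + have -> : h ^+ 2 * c + -1 * c ^+ 3 = (- c) * ((- d) * (2 * h - d)).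
      by rewrite cE; ring.
    move=> /eqP; rewrite gt_eqF// !mulr_gt0//; lra.
- exists (- h ^+ 2), 1; split.
  + by right; split; [rewrite oner_eq0|rewrite -/h; ring].
  + left; have -> : - h ^+ 2 * c + 1 * c ^+ 3 = (- c) * (d * (2 * h - d)).
      by rewrite cE; ring.
    by rewrite !mulr_gt0//; lra.
  + left; have -> : - h ^+ 2 * a + 1 * a ^+ 3 = a * (d * (d + 2 * h)).
      by rewrite aE; ring.
    by rewrite !mulr_gt0//; lra.
  + have -> : - h ^+ 2 * c + 1 * c ^+ 3 = (- c) * (d * (2 * h - d)).
      by rewrite cE; ring.
    move=> /eqP; rewrite gt_eqF// !mulr_gt0//; lra.
- have h2 : 0 < h ^+ 2 by rewrite exprn_gt0.
  exists (- h ^+ 2), 1; rewrite aE cE d0 !(add0r); split.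
  + right; split; [by rewrite oner_eq0|by field].
  + by right; split; [ring|rewrite sqrrN; lra].
  + by right; split; [ring|lra].
  + by move=> _ _; ring.
Qed.

End RealInequalities.

(** * Compact perturbations of a combination of complementary projections *)
Section CubicForm.
Variables (R : realType) (V : realHilbert R) (K D : V -> V) (a c : R) (u v : V).
Hypotheses (sK : selfadj K) (sD : selfadj D) (uv : '[u, v] = 0).
Hypotheses (Du : D u = c *: u + K u) (Dv : D v = a *: v + K v).

Let vu : '[v, u] = 0. Proof. by rewrite hdotC. Qed.
Let Kvu : '[K v, u] = '[K u, v]. Proof. by rewrite sK hdotC. Qed.

Lemma form_expansion :
  '[D (u + v), u + v] = c * '[u] + a * '[v] + '[K u, u] + '[K v, v] + 2 * '[K u, v].
Proof. by rewrite (adjD sD) Du Dv !hdotE uv vu Kvu; ring. Qed.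

(** The last line is of second order in K. *)
Lemma cubic_form_expansion : '[D (D (D (u + v))), u + v] =
  c ^+ 3 * '[u] + a ^+ 3 * '[v] +
  3 * c ^+ 2 * '[K u, u] + 3 * a ^+ 2 * '[K v, v] +
  2 * (a ^+ 2 + a * c + c ^+ 2) * '[K u, v] +
  (2 * '[K (c *: u + a *: v), K (u + v)] + '[D (K (u + v)), K (u + v)]).
Proof.
have [y yE] : exists y, y = c *: u + a *: v by exists (c *: u + a *: v).
have [k kE] : exists k, k = K (u + v) by exists (K (u + v)).
have Dx : D (u + v) = y + k by rewrite (adjD sD) Du Dv yE kE (adjD sK) addrACA.
have Dy : D y = c ^+ 2 *: u + a ^+ 2 *: v + K y.
  rewrite yE (adjD sD) !(adjZ sD) Du Dv (adjD sK) !(adjZ sK).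
  by apply: hdot_ext => z; rewrite !hdotE; ring.
rewrite sD Dx (adjD sD) !hdotE -yE -kE.
have -> : '[D k, y] = '[D y, k] by rewrite sD hdotC.
have -> : '[D y, y] = c ^+ 3 * '[u] + a ^+ 3 * '[v] + c ^+ 2 * '[K u, u] +
    a ^+ 2 * '[K v, v] + 2 * (a * c) * '[K u, v].
  by rewrite Dy yE (adjD sK) !(adjZ sK) !hdotE uv vu Kvu; ring.
have -> : '[D y, k] = c ^+ 2 * '[K u, u] + a ^+ 2 * '[K v, v] +
    (c ^+ 2 + a ^+ 2) * '[K u, v] + '[K y, k].
  by rewrite Dy !hdotDl !hdotZl kE -(sK u) -(sK v) !hdotE Kvu; ring.
ring.
Qed.

End CubicForm.

Section CompactPerturbation.
Variables (R : realType) (V : realHilbert R) (K Q : V -> V) (a c : R).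
Hypotheses (sK : selfadj K) (bK : bounded_op K) (smK : small_op K).
Hypothesis K0 : forall x, 0 <= '[K x, x].
Hypotheses (sQ : selfadj Q) (QQ : forall x, Q (Q x) = Q x).
Implicit Types (x y : V).

Lemma bounded_proj : bounded_op Q.
Proof.
exists 1 => // x; rewrite mul1r.
have E : '[Q x] = '[x, Q x] by rewrite sQ QQ.
have := hdot_ge0 (x - Q x); rewrite !hdotE (hdotC (Q x) x); lra.
Qed.

Let P x := x - Q x.

Lemma selfadj_coproj : selfadj P.
Proof. by move=> x y; rewrite /P !hdotE sQ. Qed.

Lemma bounded_coproj : bounded_op P.
Proof.
have -> : P = (fun x => id x + (-1) *: Q x).
  by apply: funext => x; rewrite /P scaleN1r.
by apply: bounded_add; [exact: bounded_id|exact/bounded_scale/bounded_proj].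
Qed.
(** With k = '[K x, x], both bounds follow from the smallness of K at x and at
    K x, the first one through the Cauchy-Schwarz inequality
    '[K x]^2 <= k '[K (K x), K x] of the form of K. *)
Lemma nonneg_near_le (e : R) : 0 < e -> \forall x \near @cofinite R V,
  '[K x] <= e * '[K x, x] /\ '[K x, x] <= e * '[x].
Proof.
move=> e0; have e2 : 0 < e ^+ 2 by rewrite exprn_gt0.
have H := cofinite_preim sK (smK e2).
near=> x.
have KK : '[K (K x)] <= e ^+ 2 * '[K x] by near: x; exact: H.
have Kx : '[K x] <= e ^+ 2 * '[x] by near: x; exact: smK.
have kx0 := hdot_ge0 (K x); have x0 := hdot_ge0 x.
have KKK : '[K (K x), K x] <= e * '[K x].
  apply: le_of_sqr; first by rewrite mulr_ge0// ltW.
  rewrite (le_trans (cauchy_schwarz _ _))// (le_trans (ler_wpM2r kx0 KK))//.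
  by rewrite exprMn expr2 -!mulrA.
have Kxx : '[K x, x] <= e * '[x].
  apply: le_of_sqr; first by rewrite mulr_ge0// ltW.
  rewrite (le_trans (cauchy_schwarz _ _))// (le_trans (ler_wpM2r x0 Kx))//.
  by rewrite exprMn expr2 -!mulrA.
split => //.
have CS : '[K x] ^+ 2 <= '[K x, x] * '[K (K x), K x].
  by apply: (cauchy_schwarz_form sK) => t.
have [kx|kxn] := eqVneq '[K x] 0; first by rewrite kx mulr_ge0// ltW.
have kxp : 0 < '[K x] by rewrite lt_def kxn.
rewrite -(ler_pM2r kxp) -expr2 (le_trans CS)// (le_trans (ler_wpM2l (K0 x) KKK))//.
by rewrite mulrA (mulrC e).
Unshelve. all: end_near. Qed.

Lemma nonneg_kernel x : '[K x, x] = 0 -> K x = 0.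
Proof.
move=> H; apply: (@form_zero _ _ K set0) => // y _ z [].
Qed.

Let D x := c *: Q x + a *: P x + K x.

Lemma selfadj_D : selfadj D.
Proof. by move=> x y; rewrite /D /P !hdotE sQ sK. Qed.

Lemma bounded_D : bounded_op D.
Proof.
apply: bounded_add => //; apply: bounded_add; apply: bounded_scale.
  exact: bounded_proj.
exact: bounded_coproj.
Qed.

Lemma QP x : Q (P x) = 0.
Proof. by rewrite /P (adjB sQ) QQ subrr. Qed.

Lemma factorsDE x : factors D [:: a; c] x =
  (a - c) *: (K (P x) - Q (K x)) + K (K x).
Proof.
have cE : D x - c *: x = (a - c) *: P x + K x.
  by apply: hdot_ext => z; rewrite /D /P !hdotE; ring.
have aE y : D y - a *: y = (c - a) *: Q y + K y.
  by apply: hdot_ext => z; rewrite /D /P !hdotE; ring.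
rewrite /= cE aE (adjD sQ) (adjZ sQ) QP (adjD sK) (adjZ sK).
by apply: hdot_ext => z; rewrite !hdotE; ring.
Qed.

Lemma small_factorsD : small_op (factors D [:: a; c]).
Proof.
have -> : factors D [:: a; c] = (fun x => (a - c) *: ((K \o P) x + (-1) *: (Q \o K) x) + (K \o K) x).
  by apply: funext => x; rewrite factorsDE scaleN1r.
apply: small_add; last exact: small_compl.
apply/small_scale/small_add.
  apply: (small_compr selfadj_coproj) => //.
  exact: bounded_coproj.
apply: small_scale; apply: small_compl => //; exact: bounded_proj.
Qed.

(** Pairing the vanishing vector (D - a)(D - c) x with v - u, where u = Q x and
    v = x - u, leaves (a - c)('[K u, u] + '[K v, v]) up to terms quadratic in
    K.  These are dominated by a small multiple of the same sum, since
    K >= 0. *)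
Lemma finite_rank_K : (\forall x \near @cofinite R V, factors D [:: a; c] x = 0) ->
  \forall x \near @cofinite R V, K x = 0.
Proof.
move=> HG; have [ac|ac] := eqVneq (a - c) 0.
  near=> x; apply: hdot_eq0; rewrite sK.
  have : factors D [:: a; c] x = 0 by near: x.
  by rewrite factorsDE ac scale0r add0r => ->; rewrite hdot0r.
have e0 : 0 < `|a - c| / 2 by rewrite divr_gt0// normr_gt0.
have HQ := cofinite_preim sQ (nonneg_near_le e0).
have HP := cofinite_preim selfadj_coproj (nonneg_near_le e0).
near=> x.
have [Ku _] : '[K (Q x)] <= `|a - c| / 2 * '[K (Q x), Q x] /\
  '[K (Q x), Q x] <= `|a - c| / 2 * '[Q x] by near: x; exact: HQ.
have [Kv _] : '[K (P x)] <= `|a - c| / 2 * '[K (P x), P x] /\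
  '[K (P x), P x] <= `|a - c| / 2 * '[P x] by near: x; exact: HP.
have : factors D [:: a; c] x = 0 by near: x; exact: HG.
move: Ku Kv; pose u := Q x; pose v := P x; rewrite -/u -/v => Ku Kv.
have xE : x = u + v by rewrite /u /v /P addrC subrK.
have Qv : Q v = 0 by exact: QP.
have Qu : Q u = u by exact: QQ.
rewrite factorsDE -/v; clearbody u v => /(congr1 (fun y => '[y, v - u])).
rewrite hdot0l !hdotE sQ sQ Qv Qu (sK (K x)) (sK (K x)).
rewrite {1 2 3 4}xE (adjD sK) !hdotE (sK v u) (hdotC v) => H.
have pu := K0 u; have pv := K0 v.
have E : (a - c) * ('[K u, u] + '[K v, v]) = '[K u] - '[K v].
  move: H; rewrite (hdotC (K v) (K u)); lra.
have : `|a - c| * ('[K u, u] + '[K v, v]) = `|'[K u] - '[K v]|.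
  by rewrite -E normrM [X in _ = _ * X]ger0_norm// addr_ge0.
have : `|'[K u] - '[K v]| <= `|a - c| / 2 * ('[K u, u] + '[K v, v]).
  have := hdot_ge0 (K u); have := hdot_ge0 (K v).
  by rewrite ler_norml; lra.
move=> H1 H2.
have nac : 0 < `|a - c| by rewrite normr_gt0.
have : `|a - c| * ('[K u, u] + '[K v, v]) <= 0 by lra.
rewrite pmulr_rle0// => H3.
have Ku0 : K u = 0 by apply: nonneg_kernel; lra.
have Kv0 : K v = 0 by apply: nonneg_kernel; lra.
by rewrite xE (adjD sK) Ku0 Kv0 addr0.
Unshelve. all: end_near. Qed.

(** Up to terms of second order in K, the form at x = u + v of a polynomial g
    in D is g(c) '[u] + g(a) '[v] + g'(c) '[K u, u] + g'(a) '[K v, v] +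
    2 g[a, c] '[K u, v], with g[a, c] the divided difference.  This is
    non-negative when g(c) and g(a) are positive, since the values of the form
    of K are small against the squared norms; where g vanishes, its derivative
    takes over because K >= 0.  The second-order terms are small against
    '[K u, u] + '[K v, v]. *)
Lemma odd_cubic_nonneg al be :
  positive_right (al * c + be * c ^+ 3) (al + 3 * be * c ^+ 2) ->
  positive_right (al * a + be * a ^+ 3) (al + 3 * be * a ^+ 2) ->
  (al * c + be * c ^+ 3 = 0 -> al * a + be * a ^+ 3 = 0 ->
      al + be * (a ^+ 2 + a * c + c ^+ 2) = 0) ->
  \forall x \near @cofinite R V, 0 <= '[al *: D x + be *: D (D (D x)), x].
Proof.
set A := al * c + _; set A' := al + _ * c ^+ 2.
set B := al * a + _; set B' := al + _ * a ^+ 2.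
set G := al + be * (_ + _) => HA HB HG.
have [C C0 HC] := bounded_form bounded_D.
have [e e0 [m0 n0 GG]] := two_level_threshold HA HB HG.
pose M := `|be| * (2 * c ^+ 2 + 2 * a ^+ 2 + 2 + 2 * C).
have c2 := sqr_ge0 c; have a2 := sqr_ge0 a.
have M0 : 0 <= M by rewrite /M mulr_ge0//; lra.
pose e1 := Num.min e (e / (M + 1)).
have e10 : 0 < e1 by rewrite lt_min e0 divr_gt0// ltr_pwDr.
have e1e : e1 <= e by rewrite ge_min lexx.
have e1M : M * e1 <= e.
  have : e1 <= e / (M + 1) by rewrite ge_min lexx orbT.
  rewrite ler_pdivlMr ?ltr_pwDr//; have := e10; lra.
have HQ := cofinite_preim sQ (nonneg_near_le e10).
have HP := cofinite_preim selfadj_coproj (nonneg_near_le e10).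
near=> x.
have [Ku1 Ku2] : '[K (Q x)] <= e1 * '[K (Q x), Q x] /\
  '[K (Q x), Q x] <= e1 * '[Q x] by near: x; exact: HQ.
have [Kv1 Kv2] : '[K (P x)] <= e1 * '[K (P x), P x] /\
  '[K (P x), P x] <= e1 * '[P x] by near: x; exact: HP.
move: Ku1 Ku2 Kv1 Kv2; pose u := Q x; pose v := P x; rewrite -/u -/v => Ku1 Ku2 Kv1 Kv2.
have xE : x = u + v by rewrite /u /v /P addrC subrK.
have Qv : Q v = 0 by exact: QP.
have Qu : Q u = u by exact: QQ.
clearbody u v.
have uv : '[u, v] = 0 by rewrite -Qu sQ Qv hdot0r.
have Du : D u = c *: u + K u by rewrite /D /P Qu; apply: hdot_ext => z; rewrite !hdotE; ring.
have Dv : D v = a *: v + K v by rewrite /D /P Qv; apply: hdot_ext => z; rewrite !hdotE; ring.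
pose y := c *: u + a *: v.
have [rho rhoE] : exists rho, rho = 2 * '[K y, K x] + '[D (K x), K x].
  by exists (2 * '[K y, K x] + '[D (K x), K x]).
have Dxx := form_expansion sK selfadj_D uv Du Dv.
have := cubic_form_expansion sK selfadj_D uv Du Dv.
rewrite -xE -/y -rhoE in Dxx * => DDDx.
have rhoM : `|be * rho| <= M * e1 * ('[K u, u] + '[K v, v]).
  rewrite normrM /M -!mulrA ler_wpM2l//.
  have H1 : `|2 * '[K y, K x]| <= '[K y] + '[K x].
    have := hdot_ge0 (K y - K x); have := hdot_ge0 (K y + K x).
    by rewrite ler_norml !hdotE (hdotC (K x) (K y)); lra.
  have H2 := HC (K x).
  have H3 : '[K x] <= 2 * '[K u] + 2 * '[K v].
    by rewrite {1 2}xE (adjD sK) hdotD_le.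
  have H4 : '[K y] <= 2 * (c ^+ 2 * '[K u]) + 2 * (a ^+ 2 * '[K v]).
    rewrite /y (adjD sK) !(adjZ sK) (le_trans (hdotD_le _ _))// !hdotE.
    by rewrite !expr2 -!mulrA.
  have H5 : C * '[K x] <= C * (2 * '[K u] + 2 * '[K v]) by exact: ler_wpM2l (ltW C0) _ _ H3.
  have k0 := hdot_ge0 (K u); have k1 := hdot_ge0 (K v).
  have q1 : 0 <= c ^+ 2 * '[K v] by rewrite mulr_ge0.
  have q2 : 0 <= a ^+ 2 * '[K u] by rewrite mulr_ge0.
  apply: (@le_trans _ _ ((2 * c ^+ 2 + 2 * a ^+ 2 + 2 + 2 * C) * ('[K u] + '[K v]))).
    rewrite rhoE (le_trans (ler_normD _ _))//; lra.
  rewrite ler_wpM2l//; lra.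
have CS : '[K u, v] ^+ 2 <= '[K u, u] * '[K v, v].
  by apply: cauchy_schwarz_form => // t.
have pu := K0 u; have pv := K0 v.
have main := form2_nonneg m0 n0 GG pu pv CS.
have A0 : 0 <= A by case: HA => [/ltW//|[-> _]].
have B0 : 0 <= B by case: HB => [/ltW//|[-> _]].
have HAu : A / e * '[K u, u] <= A * '[u].
  rewrite -mulrA ler_wpM2l// mulrC ler_pdivrMr// mulrC (le_trans Ku2)//.
  by rewrite ler_wpM2r ?hdot_ge0.
have HBv : B / e * '[K v, v] <= B * '[v].
  rewrite -mulrA ler_wpM2l// mulrC ler_pdivrMr// mulrC (le_trans Kv2)//.
  by rewrite ler_wpM2r ?hdot_ge0.
have S0 : 0 <= '[K u, u] + '[K v, v] by rewrite addr_ge0.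
have : - (e * ('[K u, u] + '[K v, v])) <= be * rho.
  move: rhoM; rewrite ler_norml => /andP[+ _].
  have := ler_wpM2r S0 e1M; lra.
rewrite hdotDl !hdotZl Dxx DDDx.
have -> : al * (c * '[u] + a * '[v] + '[K u, u] + '[K v, v] + 2 * '[K u, v]) +
   be * (c ^+ 3 * '[u] + a ^+ 3 * '[v] + 3 * c ^+ 2 * '[K u, u] +
   3 * a ^+ 2 * '[K v, v] + 2 * (a ^+ 2 + a * c + c ^+ 2) * '[K u, v] + rho) =
   A * '[u] + B * '[v] + A' * '[K u, u] + B' * '[K v, v] + 2 * G * '[K u, v] + be * rho.
  by rewrite /A /B /A' /B' /G; ring.
move: main HAu HBv.
set k1 := '[K u, u]; set k2 := '[K v, v]; set k3 := '[K u, v].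
rewrite !(mulrBl, mulrDl); lra.
Unshelve. all: end_near. Qed.

End CompactPerturbation.

(** * Linear combinations of two and of three projections *)
Section TwoProjections.
Variables (R : realType) (V : realHilbert R) (Q1 Q2 : V -> V) (b1 b2 : R).
Hypotheses (s1 : selfadj Q1) (s2 : selfadj Q2).
Hypotheses (i1 : forall x, Q1 (Q1 x) = Q1 x) (i2 : forall x, Q2 (Q2 x) = Q2 x).

Definition centred_sum x := b1 *: Q1 x + b2 *: Q2 x - ((b1 + b2) / 2) *: x.
Definition op_comm x := Q1 (Q2 x) - Q2 (Q1 x).

Lemma op_comm_skew : adjoint_pair op_comm (fun x => - op_comm x).
Proof.
by move=> x y; rewrite /op_comm !hdotE (s1 (Q2 x)) (s2 (Q1 x)) (s2 x) (s1 x); ring.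
Qed.

Let lin := (adjB s1, adjB s2, adjD s1, adjD s2, adjN s1, adjN s2, adjZ s1, adjZ s2, i1, i2).

Lemma selfadj_centred_sum : selfadj centred_sum.
Proof. by move=> x y; rewrite /centred_sum !hdotE s1 s2. Qed.

Lemma centred_sum_anticomm x : centred_sum (op_comm x) = - op_comm (centred_sum x).
Proof.
by apply: hdot_ext => z; rewrite /centred_sum /op_comm !(lin, hdotE); field.
Qed.

Lemma centred_sum_quartic x : factors centred_sum [:: (b1 + b2) / 2; - ((b1 + b2) / 2);
   (b1 - b2) / 2; - ((b1 - b2) / 2)] x = (b1 * b2) ^+ 2 *: op_comm (op_comm x).
Proof.
(* The sum of Q1 and Q2, minus the identity, squared and scaled. *)
have E1 y : centred_sum (centred_sum y - - ((b1 - b2) / 2) *: y) - ((b1 - b2) / 2) *: (centred_sum y - - ((b1 - b2) / 2) *: y) = (b1 * b2) *: (Q1 (Q2 y) + Q2 (Q1 y) + y - Q1 y - Q2 y).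
  by apply: hdot_ext => z; rewrite /centred_sum !(lin, hdotE); field.
(* The difference of Q1 and Q2, squared and scaled. *)
have E2 y : centred_sum (centred_sum y - - ((b1 + b2) / 2) *: y) - ((b1 + b2) / 2) *: (centred_sum y - - ((b1 + b2) / 2) *: y) = - (b1 * b2) *: (Q1 y + Q2 y - Q1 (Q2 y) - Q2 (Q1 y)).
  by apply: hdot_ext => z; rewrite /centred_sum !(lin, hdotE); field.
rewrite /factors /= E1 E2.
by apply: hdot_ext => z; rewrite /op_comm !(lin, hdotE); ring.
Qed.

End TwoProjections.

(** The spectrum of D is symmetric up to finitely many points because D is built
    from Q1 and Q2, and it accumulates only from above because D is a
    non-negative compact perturbation of a function of Q3. *)
Lemma finite_rank_of_combination (R : realType) (V : realHilbert R) (K Q1 Q2 Q3 : V -> V)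
    (b1 b2 b3 : R) :
  selfadj K -> bounded_op K -> small_op K -> (forall x, 0 <= '[K x, x]) ->
  selfadj Q1 -> selfadj Q2 -> selfadj Q3 ->
  (forall x, Q1 (Q1 x) = Q1 x) -> (forall x, Q2 (Q2 x) = Q2 x) ->
  (forall x, Q3 (Q3 x) = Q3 x) ->
  (forall x, x + K x = b1 *: Q1 x + b2 *: Q2 x + b3 *: Q3 x) ->
  \forall x \near @cofinite R V, K x = 0.
Proof.
move=> sK bK smK K0 s1 s2 s3 i1 i2 i3 HK.
pose a := 1 - (b1 + b2) / 2; pose c := a - b3.
pose D x := c *: Q3 x + a *: (x - Q3 x) + K x.
pose W := op_comm Q1 Q2.
have DE : D = centred_sum Q1 Q2 b1 b2.
  apply: funext => x; rewrite /D /centred_sum.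
  have -> : b1 *: Q1 x + b2 *: Q2 x = x + K x - b3 *: Q3 x by rewrite HK addrK.
  by apply: hdot_ext => z; rewrite /c /a !hdotE; ring.
have sD : selfadj D by rewrite DE; exact: selfadj_centred_sum.
have bD : bounded_op D by exact: bounded_D.
have skW : adjoint_pair W (fun x => - W x) by exact: op_comm_skew.
have DW y : D (W y) = - W (D y) by rewrite DE; exact: centred_sum_anticomm.
have smG : small_op (factors D [:: a; c]) by exact: small_factorsD.
apply: (@finite_rank_K R V K Q3 a c) => //; rewrite -/D.
(* The odd polynomial g, as a scalar times a product of linear factors. *)
have [fs [sg [sg0 Hodd Hpos]]] : exists fs (sg : R), [/\ sg != 0,
    forall x, factors D fs (W x) = - W (factors D fs x) &
    \forall x \near @cofinite R V, 0 <= sg * '[factors D fs x, x]].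
  (* If a and c are non-negative then so is D, and the identity will do for g. *)
  have [[a0 c0]|nac] := pselect (0 <= a /\ 0 <= c).
    exists [:: 0], 1; split; [exact: oner_neq0| |].
      by move=> x; rewrite /= !scale0r !subr0.
    near=> x; rewrite mul1r /= scale0r subr0 /D hdotDl.
    have q0 : '[Q3 x] = '[Q3 x, x] by rewrite s3 i3 hdotC.
    have p0 : '[x - Q3 x] = '[x - Q3 x, x].
      by rewrite !hdotE (hdotC x (Q3 x)) q0; ring.
    rewrite !hdotDl !hdotZl -p0 -q0 addr_ge0// addr_ge0// mulr_ge0// hdot_ge0//.
  have [al [be [Hs H1 H2 H3]]] := odd_cubic_exists nac.
  have := odd_cubic_nonneg sK bK smK K0 s3 i3 H1 H2 H3; rewrite -/D => Hp.
  have [[be0 al0]|[be0 alE]] := Hs.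
    exists [:: 0], al; split => //.
      by move=> x; rewrite /= !scale0r !subr0.
    near=> x; rewrite /= scale0r subr0 -hdotZl.
    have : 0 <= '[al *: D x + be *: D (D (D x)), x] by near: x.
    by rewrite be0 scale0r addr0.
  pose h := (a - c) / 2; exists [:: 0; h; - h], be; split => //.
    move=> x; rewrite /= !scale0r !subr0.
    rewrite !(DW, adjB sD, adjZ sD, adjN sD, adjB skW, adjZ skW).
    by apply: hdot_ext => z; rewrite !hdotE; ring.
  near=> x.
  have : 0 <= '[al *: D x + be *: D (D (D x)), x] by near: x.
  rewrite -hdotZl; congr (_ <= '[_, _]).
  rewrite alE /= !(adjB sD, adjZ sD) -/h.
  by apply: hdot_ext => z; rewrite !hdotE; ring.
pose E := [:: a; c; - a; - c].
pose S x := sg *: factors D (E ++ fs ++ E) x.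
have EW x : factors D E (W x) = W (factors D E x).
  rewrite (factors_anticomm sD _ _ skW DW).
  have -> : map -%R E = [:: - a; - c] ++ [:: a; c] by rewrite /= !opprK.
  by rewrite factors_catC// -signr_odd/= scale1r.
have sS : selfadj S.
  by move=> x y; rewrite /S hdotZl hdotZr (selfadj_factors sD).
have bS : bounded_op S by apply/bounded_scale/bounded_factors.
have smS : small_op S.
  by apply: small_scale; exact: (small_factors sD bD [::] [:: - a, - c & fs ++ E] smG).
have SW x : S (W x) = - W (S x).
  by rewrite /S !factors_cat EW Hodd (adjN (selfadj_factors sD _)) EW (adjZ skW) scalerN.
have S0 : \forall x \near @cofinite R V, 0 <= '[S x, x].
  have H := cofinite_preim (selfadj_factors sD E) Hpos; near=> x.
  rewrite /S !factors_cat hdotZl (selfadj_factors sD E).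
  by near: x; exact: H.
have H := cofinite_preim skW (anticommuting_nonneg_small sS bS smS skW SW S0).
pose ms := [:: (b1 + b2) / 2; - ((b1 + b2) / 2); (b1 - b2) / 2; - ((b1 - b2) / 2)].
suff Hp : \forall x \near @cofinite R V, factors D ((E ++ fs ++ E) ++ ms) x = 0.
  exact: (finite_rank_of_factors sD smG Hp).
near=> x; rewrite factors_cat [in factors D ms x]DE centred_sum_quartic// -/W.
rewrite (adjZ (selfadj_factors sD _)).
suff -> : factors D (E ++ fs ++ E) (W (W x)) = 0 by rewrite scaler0.
have : S (W (W x)) = 0 by near: x; exact: H.
by rewrite /S => /eqP; rewrite scaler_eq0 (negPf sg0) => /eqP.
Unshelve. all: end_near. Qed.

(** * The underlying real Hilbert space *)

(** A separate name for the carrier keeps the real scalar multiplication apart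
    from the complex one. *)
Definition realify (R : realType) (H : lmodType R[i]) : Type := H.

Section Realify.
Variables (R : realType) (H : lmodType R[i]).

HB.instance Definition _ := GRing.Zmodule.copy (realify H) H.

Definition real_scale (r : R) (x : realify H) : realify H := r%:C *: (x : H).

Fact real_scaleA a b x : real_scale a (real_scale b x) = real_scale (a * b) x.
Proof. by rewrite /real_scale scalerA rmorphM. Qed.

Fact real_scale1 : left_id 1 real_scale.
Proof. by move=> x; rewrite /real_scale rmorph1 scale1r. Qed.

Fact real_scaleDr : right_distributive real_scale +%R.
Proof. by move=> a x y; rewrite /real_scale scalerDr. Qed.

Fact real_scaleDl x : {morph real_scale^~ x : a b / a + b}.
Proof. by move=> a b; rewrite /real_scale rmorphD scalerDl. Qed.

HB.instance Definition _ := GRing.Zmodule_isLmodule.Build R (realify H)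
  real_scaleA real_scale1 real_scaleDr real_scaleDl.

End Realify.

Section RealPart.
Variables (R : realType) (H : completeNormedModType R[i]).
Variable dot : {dot H for Num.conj}.
Hypothesis dot_norm : forall x : H, `|x| ^+ 2 = dot x x.

Definition real_dot (x y : realify H) : R := complex.Re (dot (x : H) (y : H)).

Fact ReD (z w : R[i]) : complex.Re (z + w) = complex.Re z + complex.Re w.
Proof. by case: z w => [? ?] [? ?]. Qed.

Fact ReZ (r : R) (z : R[i]) : complex.Re (r%:C * z) = r * complex.Re z.
Proof. by case: z => u v /=; rewrite mul0r subr0. Qed.

Fact real_dotC x y : real_dot x y = real_dot y x.
Proof.
rewrite /real_dot (hermC dot (x : H) (y : H)) expr0 mul1r.
change (complex.Re (conjc (dot y x)) = complex.Re (dot y x)).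
by case: (dot y x).
Qed.

Fact real_dotDl x y z : real_dot (x + y) z = real_dot x z + real_dot y z.
Proof. by rewrite /real_dot (linearDl dot) ReD. Qed.

Fact real_dotZl (a : R) x y : real_dot (a *: x) y = a * real_dot x y.
Proof. by rewrite /real_dot (linearZl_LR dot) ReZ. Qed.

Lemma real_dot_norm (x : realify H) : (real_dot x x)%:C = `|x : H| ^+ 2.
Proof.
by rewrite /real_dot -dot_norm RRe_real// rpredX// normr_real.
Qed.

Lemma norm_le_real_dot (x : realify H) (e : R) : 0 <= e ->
  (`|x : H| <= e%:C) = (real_dot x x <= e ^+ 2).
Proof.
move=> e0; rewrite -(ler_pXn2r (n := 2))// ?nnegrE ?normr_ge0//; last first.
  by rewrite lecE /= eqxx.
by rewrite -real_dot_norm -rmorphXn lecE /= eqxx.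
Qed.

Fact real_dot_gt0 (x : realify H) : x != 0 -> 0 < real_dot x x.
Proof.
move=> x0; have : 0 < (real_dot x x)%:C.
  by rewrite real_dot_norm exprn_gt0// normr_gt0.
by rewrite ltcE /= => /andP[].
Qed.

Fact real_dot_complete (u : nat -> realify H) :
    (forall e : R, 0 < e -> exists N, forall m n, (N <= m)%N -> (N <= n)%N ->
       real_dot (u m - u n) (u m - u n) <= e) ->
  exists l, forall e : R, 0 < e -> exists N, forall n, (N <= n)%N ->
       real_dot (u n - l) (u n - l) <= e.
Proof.
move=> Hu; pose v : nat -> H := u.
have ccv : cauchy (v @ \oo).
  apply/cauchy_exP => e e0.
  have er : e = (complex.Re e)%:C by rewrite RRe_real// gtr0_real.
  have e1 : 0 < complex.Re e by move: e0; rewrite ltcE => /andP[].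
  have [|N HN] := Hu ((complex.Re e / 2) ^+ 2); first by rewrite exprn_gt0// divr_gt0.
  exists (v N); exists N => // n /= Nn; rewrite -ball_normE /=.
  apply: (@le_lt_trans _ _ (complex.Re e / 2)%:C).
    by rewrite norm_le_real_dot; [exact: (HN N n (leqnn N) Nn)|rewrite divr_ge0// ltW].
  by rewrite [ltRHS]er ltcE /= eqxx /= ltr_pdivrMr// ltr_pMr// (ltr_nat R 1 2).
have /cvg_ex[l /= vl] : cvg (v @ \oo) by exact: cauchy_cvg.
exists l => e e0.
have se : 0 < (Num.sqrt e)%:C by rewrite ltcE /= eqxx sqrtr_gt0.
have /cvgrPdist_le/(_ _ se)[N _ HN] := vl.
exists N => n Nn; rewrite -(sqr_sqrtr (ltW e0)) -norm_le_real_dot ?sqrtr_ge0//.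
by rewrite distrC; exact: HN.
Qed.

Definition real_hilbert : realHilbert R :=
  RealHilbert real_dotC real_dotDl real_dotZl real_dot_gt0 real_dot_complete.

End RealPart.

(** Here z is a finite e-net of the image of the unit ball.  For x orthogonal to
    z, the product of x with K (t K x), t K x being a unit vector, can be
    computed with a point of the net subtracted; it equals '[K x]^(1/2) and is
    at most e^(1/2) '[x]^(1/2). *)
Lemma bounded_small_of_net (R : realType) (V : realHilbert R) (K : V -> V) : selfadj K ->
  (forall e : R, 0 < e -> exists z : seq V, forall x, '[x] <= 1 ->
     exists2 w, w \in z & '[K x - w] <= e) ->
  bounded_op K /\ small_op K.
Proof.
move=> sK net.
have scale_le C : 0 <= C -> forall x, (forall t, '[t *: x] <= 1 -> '[K (t *: x)] <= C) ->
   '[K x] <= C * '[x].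
  move=> C0 x H; have [->|x0] := eqVneq x 0.
    by rewrite (adj0 sK) !hdot0r mulr0.
  have xp := hdot_gt0 x0.
  pose t := (Num.sqrt '[x])^-1.
  have t2 : t * t = '[x]^-1 by rewrite -expr2 exprVn sqr_sqrtr ?ltW.
  have := H t; rewrite (adjZ sK) !hdotE !mulrA t2 mulVf ?gt_eqF// => /(_ (lexx _)).
  by rewrite mulrC ler_pdivrMr.
split.
  have [z Hz] := net 1 ltr01.
  pose M := \sum_(w <- z) '[w].
  have M0 : 0 <= M by apply: sumr_ge0 => w _; exact: hdot_ge0.
  exists (2 + 2 * M); first by lra.
  move=> x; apply: scale_le; first by lra.
  move=> t /Hz[w wz Kw].
  have wM : '[w] <= M.
    by rewrite /M (big_rem w wz)/= lerDl sumr_ge0// => v _; exact: hdot_ge0.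
  have := hdotD_le (K (t *: x) - w) w; rewrite subrK; lra.
move=> e e0; have [z Hz] := net e e0; exists z => x xz.
have [Kx0|Kx0] := eqVneq '[K x] 0; first by rewrite Kx0 mulr_ge0 ?hdot_ge0// ltW.
have Kxp : 0 < '[K x] by rewrite lt_def Kx0 hdot_ge0.
pose t := (Num.sqrt '[K x])^-1.
have t2 : t ^+ 2 = '[K x]^-1 by rewrite exprVn sqr_sqrtr ?ltW.
have [|w wz Kw] := Hz (t *: K x).
  by rewrite hdotZl hdotZr mulrA -expr2 t2 mulVf.
have H : '[x, K (t *: K x) - w] = t * '[K x].
  by rewrite hdotDr hdotNr (xz w wz) subr0 (adjZ sK) hdotZr [in RHS]sK.
have := cauchy_schwarz x (K (t *: K x) - w).
rewrite H exprMn t2 expr2 mulKf// => H1; apply: le_trans H1 _.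
by rewrite mulrC ler_wpM2r ?hdot_ge0.
Qed.

Lemma finite_dim_of_cofinite (R : realType) (V : realHilbert R) (K : V -> V) :
  selfadj K -> (\forall x \near @cofinite R V, K x = 0) ->
  exists e : seq V, forall x, exists c : nat -> R,
    K x = \sum_(i < size e) c i *: e`_i.
Proof.
move=> sK [z Hz].
(* The constraints of z are dropped one at a time, keeping the values of K on
   the remaining subspace in the span of a growing list e. *)
suff H (e : seq V) : (forall x, perp z x -> exists c : nat -> R,
      K x = \sum_(i < size e) c i *: e`_i) ->
    exists e : seq V, forall x, exists c : nat -> R,
      K x = \sum_(i < size e) c i *: e`_i.
  by apply: (H [::]) => x /Hz ->; exists (fun=> 0); rewrite big_ord0.
elim: z e {Hz} => [|w z IH] e He; first by exists e => x; exact: He.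
have [w0|] := pselect (forall x, perp z x -> '[x, w] = 0).
  apply: (IH e) => x xz; apply: He => v; rewrite inE => /orP[/eqP->|/xz//].
  exact: w0.
move=> /existsNP[x0 /not_implyP[zx0 /eqP x0w]].
apply: (IH (K x0 :: e)) => x xz.
pose t := '[x, w] / '[x0, w].
have [|c Hc] := He (x - t *: x0).
  move=> v; rewrite inE => /orP[/eqP->|vz].
    by rewrite hdotDl hdotNl hdotZl divfK// subrr.
  by rewrite hdotDl hdotNl hdotZl xz// zx0// mulr0 subr0.
exists (fun i => if i is j.+1 then c j else t).
by rewrite big_ord_recl/= -Hc (adjB sK) (adjZ sK) addrC subrK.
Qed.

Section Transfer.
Variables (R : realType) (H : completeNormedModType R[i]).
Variable dot : {dot H for Num.conj}.
Hypothesis dot_norm : forall x : H, `|x| ^+ 2 = dot x x.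

Let V := real_hilbert dot_norm.

Lemma selfadj_real (T : {linear H -> H}) : self_adjoint dot T -> @selfadj R V T.
Proof. by move=> sT x y; rewrite /= /real_dot sT. Qed.

Lemma compact_net (T : {linear H -> H}) : compact_operator T ->
  forall e : R, 0 < e -> exists z : seq V, forall x : V, '[x] <= 1 ->
     exists2 w : V, w \in z & '[(T x : V) - w] <= e.
Proof.
rewrite /compact_operator precompactE compact_cover => cT e e0.
pose r := Num.sqrt e; have r0 : 0 < r by rewrite sqrtr_gt0.
have rC : 0 < r%:C by rewrite ltcE /= eqxx.
have [|x Tx|D _ HD] := cT H setT (fun w => ball w r%:C).
- by move=> w _; exact: ball_open.
- by exists x => //; exact: ballxx.
exists (finmap.enum_fset D) => x x1.
have : closure [set T y | y in [set y | `|y| <= 1]] (T x).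
  apply: subset_closure; exists x => //=.
  by rewrite (norm_le_real_dot dot_norm x ler01) expr1n.
move=> /HD[w wD]; rewrite -ball_normE /= => Hw; exists w => //.
rewrite -(sqr_sqrtr (ltW e0)) -(norm_le_real_dot dot_norm) ?sqrtr_ge0//.
by rewrite distrC ltW.
Qed.

End Transfer.

Theorem corollary4p3 (R : realType) (H : completeNormedModType R[i])
    (dot : {dot H for Num.conj})
    (dot_norm : forall x : H, `|x| ^+ 2 = dot x x)
    (H_separable : separable H)
    (H_infinite_dimensional : ~ finite_dimensional [set: H])
    (K : {linear H -> H})
    (K_self_adjoint : self_adjoint dot K)
    (K_nonneg : nonneg_operator dot K)
    (K_compact : compact_operator K)
    (K_infinite_rank : infinite_rank K) :
  ~ exists (b1 b2 b3 : R) (Q1 Q2 Q3 : {linear H -> H}),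
      [/\ orthoprojection dot Q1, orthoprojection dot Q2,
          orthoprojection dot Q3 &
          forall x, x + K x = b1%:C *: Q1 x + b2%:C *: Q2 x + b3%:C *: Q3 x].
Proof.
move=> [b1 [b2 [b3 [Q1 [Q2 [Q3 [[_ s1 i1] [_ s2 i2] [_ s3 i3] HK]]]]]]].
pose V := real_hilbert dot_norm.
have sK := selfadj_real (dot_norm := dot_norm) K_self_adjoint.
have [bK smK] := bounded_small_of_net sK (compact_net dot_norm K_compact).
have K0 (x : V) : 0 <= '[(K x : V), x].
  by have := K_nonneg x; rewrite lecE => /andP[].

have := @finite_rank_of_combination R V K Q1 Q2 Q3 b1 b2 b3 sK bK smK K0
  (selfadj_real (dot_norm := dot_norm) s1) (selfadj_real (dot_norm := dot_norm) s2) (selfadj_real (dot_norm := dot_norm) s3)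
  i1 i2 i3 HK.
move=> /(finite_dim_of_cofinite sK)[e He]; apply: K_infinite_rank.
exists (size e), (fun i => e`_i : H) => _ [x _ <-].
have [c Hc] := He x; by exists (fun i => (c i)%:C); rewrite Hc.
Qed.
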